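(* Let $L$ be the weighted graph Laplacian of the low-order DG discretization with penalty parameter $\eta$, $D$ its diagonal, and $Q$ the orthogonal projection onto the range of the AMG interpolation operator, as defined in the context. Let $u\in\mathbb R^V$ be given. Then the decomposition $u=v+w$, where $w=Qu$, is stable in the sense that $$v^TDv+w^TLw\le C\,u^TLu,$$ where the constant $C$ is independent of $u$ and of $\eta$.
   Context: **Graph and weights.** Let $\mathcal T_p$ be a hexahedral mesh of a domain $\Omega\subseteq\mathbb R^3$, with elements $\kappa=T_\kappa([-1,1]^3)$. Let $x_1<\dots<x_{p+1}$ be the $p+1$ Gauss--Lobatto points on $[-1,1]$ with quadrature weights $w_i$, and $x_1'<\dots<x_{p+2}'$ the $p+2$ Gauss--Lobatto points; each $[x_i',x_{i+1}']$ contains exactly one $x_i$. $\mathcal T_h'$ is obtained by subdividing each $\kappa$ into $(p+1)^3$ subelements using the Cartesian grid of the $x_i'$. $G=(V,E)$ is the graph with one vertex per element of $\mathcal T_h'$ and an edge whenever two elements share a face $e$ ($G$ is connected); it carries the edge weight $w_{ij}=\sigma_h(e)>0$. Let $\alpha=\widehat h/h>0$ be the ratio of reference to physical element size at $e$ (sizes computed as element measure over face measure, averaged over the two adjacent elements). If $e$ lies in the interior of a coarse element $\kappa$ and is the image of $[x_i',x_{i+1}']\times[x_j',x_{j+1}']\times\{x_k'\}$ (or analogous for other directions), then $\sigma_h(e)=\alpha w_iw_j/\big((x_{i+1}'-x_i')(x_{j+1}'-x_j')(z^+-z^-)\big)$, with $w_i,w_j$ the weights of the unique nodes in the two intervals and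 $z^-,z^+$ the nodes in $[x_{k-1}',x_k']$ and $[x_k',x_{k+1}']$; such edges form the set $E^\circ$ of interior edges, whose weights are independent of $\eta$. If $e$ is contained in a face of the coarse mesh $\mathcal T_p$, corresponding to $[x_i',x_{i+1}']\times[x_j',x_{j+1}']$, then $\sigma_h(e)=\alpha\eta p^2w_iw_j$; such edges form the set $E^\partial$ of boundary edges, whose weights scale linearly with $\eta$. $L$ is the matrix with $L_{ij}=-w_{ij}$ for adjacent $i\ne j$, $L_{ii}=w_i:=\sum_{j\sim i}w_{ij}$, and zero otherwise; thus $u^TLu=\sum_{(i,j)\in E}w_{ij}(u_i-u_j)^2$. $D$ is the diagonal of $L$. **Components.** It is assumed that $\eta\gg1$, in particular $\eta\ge1$. $V$ is partitioned as $V^{(1)}\cup\dots\cup V^{(n)}\cup V^\circ$: the $V^{(i)}$ are the strongly connected components, i.e. the connected components (with at least two vertices) of the graph $(V,E^\partial)$, and $V^\circ$ consists of the vertices belonging to no boundary edge. The number of vertices of each $V^{(i)}$ is bounded by the valence of $\mathcal T_p$, assumed $O(1)$. **Projection.** Vertices are split into coarse (C) and fine (F) points, $P=\begin{pmatrix}W\\ I\end{pmatrix}$ is the C-to-F interpolation operator, assumed to preserve constants, and $Q=P(P^TP)^{-1}P^T$. Because $\eta\gg1$, $Q$ is decoupled across $V^{(1)},\dots,V^{(n)},V^\circ$ (block diagonal for this partition); $Q^{(i)}$ and $Q^\circ$ denote the operators acting as the corresponding block of $Q$ on $V^{(i)}$, resp. $V^\circ$, and as the identity on all other vertices, so $Q=Q^\circ\prod_iQ^{(i)}$.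 Each block is an orthogonal projection with all row sums equal to one and all entries of absolute value at most one. *)

(* Defs.v *)
From HB Require Import structures.
From mathcomp Require Import all_boot all_order all_algebra all_fingroup.
From mathcomp Require Import all_classical all_reals all_analysis.

Set Implicit Arguments.
Unset Strict Implicit.
Unset Printing Implicit Defensive.

Import Order.TTheory GRing.Theory Num.Theory.
Import numFieldNormedType.Exports.

Local Open Scope classical_set_scope.
Local Open Scope ring_scope.

(* The Gauss--Lobatto rule with n.+1 nodes on [-1, 1]: it contains both end
   points and is exact in degree at most 2 n - 1, i.e. for size q <= 2 n.
   These requirements determine x and w. *)
Definition gauss_lobatto (R : realType) (n : nat) (x w : 'I_n.+1 -> R) : Prop :=
  [/\ {homo x : i j / (i < j)%N >-> i < j},
      x ord0 = -1,
      x ord_max = 1 &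
      forall q : {poly R}, (size q <= n.*2)%N ->
        \sum_i w i * q.[x i] =
        \int[@lebesgue_measure R]_(t in [set t : R | -1 <= t <= 1]) q.[t]].

Section HexMesh.
Context {R : realType}.
Local Notation point := 'rV[R]_3.
Local Notation mu := (@lebesgue_measure R).

Definition ref_cube : set point :=
  [set y | forall d, -1 <= y ord0 d <= 1].

(* A face of any dimension of the cube: c d = Some b fixes the d-th coordinate
   at 1 or -1, and c d = None leaves it free. *)
Definition cube_face (c : 'I_3 -> option bool) : set point :=
  ref_cube `&` [set y | forall d b, c d = Some b ->
                        y ord0 d = if b then 1 else -1].

Definition facet (d : 'I_3) (b : bool) : 'I_3 -> option bool :=
  fun c => if c == d then Some b else None.

Definition cube_symmetry (s : {perm 'I_3}) (b : 'I_3 -> bool) (y : point) :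
  point := \row_d ((-1) ^+ b d * y ord0 (s d)).

Definition C1_on_cube (f : point -> point) : Prop :=
  (forall y, ref_cube y -> differentiable f y) /\
  (forall d : 'I_3,
     {within ref_cube, continuous (fun y => 'D_(delta_mx ord0 d) f y)}).

(* Two distinct elements that meet do so along a common proper face, on which
   their parametrizations agree up to a symmetry of the reference cube. *)
Definition conforming (K : finType) (T : K -> point -> point) : Prop :=
  forall k l : K, k != l ->
    T k @` ref_cube `&` T l @` ref_cube = set0 \/
    exists (c : 'I_3 -> option bool) (s : {perm 'I_3}) (b : 'I_3 -> bool),
      [/\ exists d, c d != None,
          T k @` ref_cube `&` T l @` ref_cube = T k @` cube_face c &
          forall y, cube_face c y -> T l (cube_symmetry s b y) = T k y].

Definition hex_mesh (Omega : set point) (K : finType)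
    (T : K -> point -> point) : Prop :=
  [/\ [/\ open Omega, connected Omega & Omega !=set0],
      closure Omega = \bigcup_k (T k @` ref_cube),
      forall k, C1_on_cube (T k) /\ {in ref_cube &, injective (T k)} &
      conforming T].

Definition volume (A : set point) : R :=
  fine ((mu \x (mu \x mu))%E
    [set t : R * (R * R) | A (\row_d [:: t.1; t.2.1; t.2.2]`_d)]).

(* The point with d-th coordinate z, the other two being s and t. *)
Definition plane_pt (d : 'I_3) (z s t : R) : point :=
  \row_c (if unlift d c is Some j then (if j == ord0 then s else t) else z).

Definition dot (a b : point) : R := (a *m b^T) ord0 ord0.

(* Area of the image under f of I x J, placed in the plane y_d = z:
   integral of |df/ds x df/dt| = sqrt(|df/ds|^2 |df/dt|^2 - (df/ds.df/dt)^2). *)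
Definition surface_area (f : point -> point) (d : 'I_3) (z : R)
    (I J : set R) : R :=
  \int[(mu \x mu)%E]_(st in (I `*` J : set (R * R)))
    (let y := plane_pt d z st.1 st.2 in
     let a := 'D_(delta_mx ord0 (lift d (ord0 : 'I_2))) f y in
     let b := 'D_(delta_mx ord0 (lift d (ord_max : 'I_2))) f y in
     Num.sqrt (dot a a * dot b b - dot a b ^+ 2)).

End HexMesh.

(* The mesh T_p with the two Gauss--Lobatto grids: gl_x, gl_w are the p+1 nodes
   and weights, sub_x (with weights sub_w) the p+2 nodes of the subdivision. *)
Record dg_mesh (R : realType) (p : nat) := DGMesh {
  domain : set 'rV[R]_3;
  coarse : finType;
  emap : coarse -> 'rV[R]_3 -> 'rV[R]_3;
  gl_x : 'I_p.+1 -> R;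
  gl_w : 'I_p.+1 -> R;
  sub_x : 'I_p.+2 -> R;
  sub_w : 'I_p.+2 -> R;
  meshP : hex_mesh domain emap;
  glP : gauss_lobatto gl_x gl_w;
  subP : gauss_lobatto sub_x sub_w
}.

Section LowOrderGraph.
Context {R : realType} {p : nat} (M : dg_mesh R p).

(* (k, i) is the image under T_k of the cell prod_d [x'_(i d), x'_(i d + 1)]. *)
Definition vertex : finType := (coarse M * {ffun 'I_3 -> 'I_p.+1})%type.

Definition bound (i : 'I_p.+1) (b : bool) : R :=
  sub_x M (lift (if b then ord0 else ord_max) i).

Definition cell_itv (i : 'I_p.+1) : set R :=
  [set t | bound i false <= t <= bound i true].

Definition width (i : 'I_p.+1) : R := bound i true - bound i false.

Definition ref_cell (a : vertex) : set 'rV[R]_3 :=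
  [set y | forall d, cell_itv (a.2 d) (y ord0 d)].

Definition cell (a : vertex) : set 'rV[R]_3 := emap a.1 @` ref_cell a.

(* (a, (d, b)): the face of the subelement a orthogonal to the reference
   direction d, at the upper end if b and at the lower end otherwise. *)
Definition side : finType := (vertex * ('I_3 * bool))%type.

Definition side_pos (f : side) : R := bound (f.1.2 f.2.1) f.2.2.

Definition face (f : side) : set 'rV[R]_3 :=
  emap f.1.1 @` (ref_cell f.1 `&` [set y | y ord0 f.2.1 = side_pos f]).

Definition is_face (a : vertex) (e : set 'rV[R]_3) : Prop :=
  exists db, face (a, db) = e.

Definition shared (a b : vertex) : set (set 'rV[R]_3) :=
  [set e | is_face a e /\ is_face b e].

Definition adj : rel vertex :=
  fun a b => (a != b) && `[< shared a b !=set0 >].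

Definition common_face (a b : vertex) : set 'rV[R]_3 := xget set0 (shared a b).

Definition in_coarse_face (e : set 'rV[R]_3) : Prop :=
  exists k d b, e `<=` @emap _ _ M k @` cube_face (facet d b).

(* The two sides of different subelements whose common image is e.  Nothing
   below depends on the choice of their order: Gauss--Lobatto rules are
   symmetric and the parametrizations of a conforming mesh match on e. *)
Definition sides_of (e : set 'rV[R]_3) : option (side * side) :=
  [pick fg : side * side |
    (fg.1.1 != fg.2.1) && `[< face fg.1 = e /\ face fg.2 = e >]].

Definition ref_size (f : side) : R :=
  (\prod_d width (f.1.2 d)) / (\prod_(d | d != f.2.1) width (f.1.2 d)).

Definition face_area (f : side) : R :=
  surface_area (emap f.1.1) f.2.1 (side_pos f)
    (cell_itv (f.1.2 (lift f.2.1 (ord0 : 'I_2))))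
    (cell_itv (f.1.2 (lift f.2.1 (ord_max : 'I_2)))).

Definition phys_size (f : side) : R := volume (cell f.1) / face_area f.

Definition alpha (e : set 'rV[R]_3) : R :=
  if sides_of e is Some (f, g)
  then ((ref_size f + ref_size g) / 2) / ((phys_size f + phys_size g) / 2)
  else 0.

(* The index k such that f lies in the reference plane y_d = x'_k. *)
Definition plane_index (f : side) : nat := (f.1.2 f.2.1 + f.2.2)%N.

(* sigma_h(e).  By interlacing, gl_x i is the unique node in
   [x'_i, x'_(i+1)], so z^- and z^+ are the nodes of index k - 1 and k. *)
Definition sigma (eta : R) (e : set 'rV[R]_3) : R :=
  if sides_of e is Some (f, _) then
    let i := f.1.2 in
    let d := f.2.1 in
    let k := plane_index f in
    if `[< in_coarse_face e >] then
      alpha e * eta * p%:R ^+ 2 * \prod_(c | c != d) gl_w M (i c)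
    else
      alpha e * (\prod_(c | c != d) gl_w M (i c)) /
        ((\prod_(c | c != d) width (i c)) *
         (gl_x M (inord k) - gl_x M (inord k.-1)))
  else 0.

Definition weight (eta : R) (a b : vertex) : R :=
  if adj a b then sigma eta (common_face a b) else 0.

Definition laplacian (eta : R) : 'M[R]_#|vertex| :=
  \matrix_(i, j) (if i == j then \sum_b weight eta (enum_val i) b
                  else - weight eta (enum_val i) (enum_val j)).

Definition laplacian_diag (eta : R) : 'M[R]_#|vertex| :=
  diag_mx (\row_i laplacian eta i i).

Definition bdry_adj : rel vertex :=
  fun a b => adj a b && `[< in_coarse_face (common_face a b) >].

Definition Vcirc : {set vertex} := [set a | [forall b, ~~ bdry_adj a b]]%SET.

Definition strong_components : {set {set vertex}} :=
  equivalence_partition (connect bdry_adj) (~: Vcirc).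

Definition blocks : {set {set vertex}} := (Vcirc |: strong_components)%SET.

(* P is the identity on coarse points; its remaining rows form W. *)
Definition interpolation (C : {set vertex}) (P : 'M[R]_(#|vertex|, #|C|)) :
  Prop :=
  forall i j, enum_val i \in C ->
    P i j = (enum_val i == enum_val j :> vertex)%:R.

Definition range_proj (C : {set vertex}) (P : 'M[R]_(#|vertex|, #|C|)) :
  'M[R]_#|vertex| := P *m invmx (P^T *m P) *m P^T.

Definition decoupled (Q : 'M[R]_#|vertex|) : Prop :=
  forall i j, Q i j != 0 ->
    exists2 B, B \in blocks & (enum_val i \in B) && (enum_val j \in B).

End LowOrderGraph.

Definition quad_form (R : realType) (n : nat) (A : 'M[R]_n) (u : 'cV[R]_n) : R :=
  (u^T *m A *m u) ord0 ord0.

(* Main.v *)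
(** On V_circ the degrees do not depend on eta, and on a strong component they
    are O(eta).  The residual at a vertex a is sum_b Q_ab (u_a - u_b), where b
    ranges over the block of a.  Joining a to b by a path, inside the strong
    component when a lies in one, bounds (u_a - u_b)^2 by O(1/t) u^T L u, where
    t = eta on a strong component and t = 1 on V_circ; this compensates the
    degree of a, which is O(t).  The Laplacian part follows from
    w = u - v and v^T L v <= 2 v^T D v.  All edge weights are positive because
    Gauss-Lobatto weights are: apply the rule to a nonnegative polynomial that
    vanishes at all nodes but one. *)

Require Import Defs.
From mathcomp Require Import all_boot all_order all_algebra.
From mathcomp Require Import all_classical all_reals all_analysis.
From mathcomp Require Import ring lra zify.
Import Order.TTheory GRing.Theory Num.Theory.
Import numFieldNormedType.Exports.
Local Open Scope ring_scope.
Set Implicit Arguments.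
Unset Strict Implicit.

(** * Positivity of the Gauss-Lobatto weights *)

Lemma finite_roots (F : idomainType) (q : {poly F}) :
  q != 0 -> finite_set [set t | root q t]%classic.
Proof.
move=> q0; apply: contrapT => /infinite_set_fsetP /(_ (size q)) [B sB].
rewrite leqNgt; apply/negP/negPn/max_poly_roots => //.
  by apply/allP => t tB; exact: sB.
exact: finmap.fset_uniq.
Qed.

(** If the integral were zero, [q] would vanish almost everywhere, so an interval of length
    [b - a > 0] would be covered by a null set and the finitely many roots of [q]. *)
Lemma Rintegral_poly_gt0 (R : realType) (a b : R) (q : {poly R}) :
  a < b -> q != 0 -> (forall t, a <= t <= b -> 0 <= q.[t]) ->
  0 < \int[@lebesgue_measure R]_(t in [set t : R | a <= t <= b]%classic) q.[t].
Proof.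
move=> ab q0 qge0.
have -> : [set t : R | a <= t <= b]%classic = `[a, b]%classic.
  by rewrite set_itvcc.
have qab t : `[a, b]%classic t -> 0 <= q.[t].
  by rewrite /= ?in_itv; exact: qge0.
rewrite lt_neqAle Rintegral_ge0// andbT eq_sym; apply/negP => /eqP int0.
have qint : (@lebesgue_measure R).-integrable `[a, b]%classic
    (EFin \o (horner q)).
  apply: continuous_compact_integrable; first exact: segment_compact.
  exact/continuous_subspaceT/continuous_horner.
have : (\int[@lebesgue_measure R]_(t in `[a, b]%classic) `|(q.[t])%:E|)%E = 0%E.
  transitivity (\int[@lebesgue_measure R]_(t in `[a, b]%classic)
      (EFin \o horner q) t)%E.
    apply: eq_integral => t; rewrite inE => /qab qt.
    by rewrite gee0_abs ?lee_fin.
  rewrite -[LHS]fineK; last exact: integrable_fin_num.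
  by rewrite -[fine _]/(Rintegral _ _ _) int0.
have mD : (@measurable _ (measurableTypeR R)) `[a, b]%classic.
  exact: measurable_itv.
move/(ae_eq_integral_abs (@lebesgue_measure R) mD (measurable_int _ qint)).
move=> [N [mN N0 sub]].
have croots : countable [set t | root q t]%classic.
  exact/finite_set_countable/finite_roots.
have : (@lebesgue_measure R `[a, b]%classic <=
    @lebesgue_measure R (N `|` [set t | root q t])%classic)%E.
  apply: le_measure; rewrite ?inE; first exact: measurable_itv.
    apply: measurableU => //; exact: countable_measurable.
  move=> t tab; have [qt|qt] := boolP (root q t); first by right.
  left; apply: sub => /= /(_ tab) [] qt0.
  by move: qt; rewrite /root qt0 eqxx.
rewrite measureU0//; last 2 first.
- exact: countable_measurable.
- exact: countable_lebesgue_measure0.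
rewrite N0 lebesgue_measure_itv /= lte_fin ab -EFinB lee_fin.
by rewrite subr_le0 leNgt ab.
Qed.

Lemma gauss_lobatto_weight_gt0 (R : realType) (n : nat) (x w : 'I_n.+1 -> R) :
  (0 < n)%N -> gauss_lobatto x w -> forall i, 0 < w i.
Proof.
move=> n0 [xinc x0 x1 gl_exact] i.
have xm : {mono x : a b / (a < b)%N >-> a < b}.
  move=> a b; case: (ltngtP a b) => [ab|ba|/val_inj ->].
  - by rewrite xinc.
  - by apply/negbTE; rewrite -leNgt ltW // xinc.
  - by rewrite ltxx.
have x_lo j : -1 <= x j by rewrite -x0 leNgt xm.
have x_hi j : x j <= 1 by rewrite -x1 leNgt xm -leqNgt -ltnS ltn_ord.
(* Interior nodes need a squared factor to keep the sign. At the end points a linear factor is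
   already nonnegative on [-1, 1], and this saves the degree that exactness requires. *)
pose F (j : 'I_n.+1) : {poly R} :=
  if j == ord0 then 'X + 1
  else if j == ord_max then 1 - 'X else ('X - (x j)%:P) ^+ 2.
have F_ge0 j t : -1 <= t <= 1 -> 0 <= (F j).[t].
  rewrite /F; do 2?case: ifP => _; rewrite !hornerE; first lra.
    by lra.
  by rewrite sqr_ge0.
have F_root j : (F j).[x j] = 0.
  rewrite /F; do 2?case: ifP => [/eqP ->|_]; rewrite !hornerE.
  - by rewrite x0 addNr.
  - by rewrite x1 subrr.
  - by rewrite subrr expr0n.
have F_gt0 j : j != i -> 0 < (F j).[x i].
  move=> ji; rewrite lt_neqAle F_ge0 ?x_lo ?x_hi // andbT eq_sym.
  have xji : x i - x j != 0.
    rewrite subr_eq0; apply: contraNneq ji => xij.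
    apply/eqP/val_inj; case: (ltngtP j i) => // /xinc; by rewrite xij ltxx.
  move: xji; rewrite /F; do 2?case: ifP => [/eqP ->|_]; rewrite !hornerE.
  - by rewrite x0 opprK.
  - by rewrite x1 -opprB oppr_eq0.
  - by move=> h; rewrite expf_neq0.
pose q := \prod_(j | j != i) F j.
have qi : 0 < q.[x i] by rewrite horner_prod prodr_gt0.
have q_size : (size q <= n.*2)%N.
  apply: leq_trans (size_poly_prod_leq _ _) _.
  (* An end point other than [i]: its linear factor has size 2 and the other n - 1 factors have size
     at most 3, so the product has size at most 2 + 3 (n - 1) + 1 - n = 2 n. *)
  pose e : 'I_n.+1 := if i == ord0 then ord_max else ord0.
  have ei : e != i.
    rewrite /e; case: ifP => [/eqP ->|/negbT]; last by rewrite eq_sym.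
    by rewrite -val_eqE /= -lt0n.
  have Fe : (size (F e) <= 2)%N.
    rewrite /e /F; case: (i == ord0); last by rewrite eqxx -polyC1 size_XaddC.
    rewrite eqxx -val_eqE /= -[n == 0]negbK -lt0n n0 /=.
    by rewrite -opprB size_polyN -polyC1 size_XsubC.
  have F3 j : (size (F j) <= 3)%N.
    rewrite /F; do 2?case: ifP => _; last by rewrite size_exp_XsubC.
    - by rewrite -polyC1 size_XaddC.
    - by rewrite -opprB size_polyN -polyC1 size_XsubC.
  have cardi : #|(fun j : 'I_n.+1 => j != i)| = n.
    by have := cardC1 i; rewrite card_ord.
  rewrite cardi (bigD1 e) //=.
  have : (\sum_(j | (j != i) && (j != e)) size (F j) <= n.-1 * 3)%N.
    apply: leq_trans (_ : \sum_(j | (j != i) && (j != e)) 3 <= _)%N.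
      by apply: leq_sum => j _; exact: F3.
    rewrite sum_nat_const leq_mul2r /=.
    have := @cardD1x _ (fun j : 'I_n.+1 => j != i) _ ei.
    by rewrite cardi => cE; rewrite [in X in (_ <= X)%N]cE.
  have arith a b : (a <= 2 -> b <= n.-1 * 3 -> (a + b).+1 - n <= n.*2)%N by lia.
  exact: arith Fe.
have q0 : q != 0 by apply: contraTneq qi => ->; rewrite horner0 ltxx.
(* By exactness the integral is [w i * q.[x i]], every other node being a root of [q]. *)
have := @Rintegral_poly_gt0 R (-1) 1 q.
rewrite -gl_exact // (bigD1 i) //= big1 => [|j ji]; last first.
  by rewrite /q horner_prod (bigD1 j) //= F_root mul0r mulr0.
rewrite addr0 pmulr_lgt0 //; apply=> //.
by move=> t t1; rewrite /q horner_prod; apply: prodr_ge0 => j _; exact: F_ge0.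
Qed.

(** * Path estimates and the energy of a weighted graph *)

(** Differences telescope along a path, which may be taken without repeated vertices and so has
    fewer than [#|T|] edges. *)
Lemma connect_norm_le (R : realDomainType) (T : finType) (e : rel T)
    (f : T -> R) (s : R) (a b : T) :
  0 <= s -> (forall x y, e x y -> `|f x - f y| <= s) -> connect e a b ->
  `|f a - f b| <= #|T|%:R * s.
Proof.
move=> s0 fe /connectP [q eq ->]; case/shortenP: eq => r er /card_uniqP rT _.
have /le_trans -> // : `|f a - f (last a r)| <= (size r)%:R * s; last first.
  rewrite ler_wpM2r // ler_nat -ltnS -[(size r).+1]/(size (a :: r)) -rT.
  exact: leqW (max_card _).
elim: r a er {rT} => [|c r IH] a /=; first by rewrite subrr normr0 mul0r.
move=> /andP[ac /IH rc]; rewrite -natr1 mulrDl mul1r [leRHS]addrC.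
have -> : f a - f (last c r) = f a - f c + (f c - f (last c r)) by ring.
by apply: le_trans (ler_normD _ _) _; rewrite lerD // fe.
Qed.

(* Sum over ordered pairs, i.e. twice the Laplacian quadratic form. *)
Definition energy (R : pzRingType) (T : finType) (c : T -> T -> R)
    (f : T -> R) : R :=
  \sum_a \sum_b c a b * (f a - f b) ^+ 2.

Section Energy.
Variables (R : realType) (T : finType).
Implicit Types (c : T -> T -> R) (f g : T -> R).

Lemma energy_ge0 c f : (forall a b, 0 <= c a b) -> 0 <= energy c f.
Proof.
by move=> c0; do 2!apply: sumr_ge0 => ? _; rewrite mulr_ge0 ?sqr_ge0.
Qed.

Lemma energy_edge c f a b :
  (forall a b, 0 <= c a b) -> c a b * (f a - f b) ^+ 2 <= energy c f.
Proof.
move=> c0; rewrite /energy (bigD1 a) //= (bigD1 b) //= -addrA lerDl.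
by rewrite addr_ge0 //; repeat (apply: sumr_ge0 => ? _);
  rewrite mulr_ge0 ?sqr_ge0.
Qed.

Lemma energyD c f g :
  (forall a b, 0 <= c a b) ->
  energy c (fun a => f a + g a) <= 2 * (energy c f + energy c g).
Proof.
move=> c0; rewrite /energy -big_split mulr_sumr; apply: ler_sum => a _.
rewrite -big_split mulr_sumr; apply: ler_sum => b _ /=.
rewrite -mulrDr [leRHS]mulrCA ler_wpM2l //.
have := sqr_ge0 ((f a - f b) - (g a - g b)).
by nra.
Qed.

Lemma energyN c f : energy c (fun a => - f a) = energy c f.
Proof.
by apply: eq_bigr => a _; apply: eq_bigr => b _; congr (_ * _); ring.
Qed.

(** From (x - y)^2 <= 2 x^2 + 2 y^2; by symmetry of [c] both squares contribute the same sum, whence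
    the factor 4. *)
Lemma energy_le_diag c f :
  (forall a b, 0 <= c a b) -> (forall a b, c a b = c b a) ->
  energy c f <= 4 * \sum_a (\sum_b c a b) * f a ^+ 2.
Proof.
move=> c0 csym.
have -> : 4 * (\sum_a (\sum_b c a b) * f a ^+ 2) =
    \sum_a \sum_b c a b * (2 * f a ^+ 2 + 2 * f b ^+ 2).
  transitivity (\sum_a \sum_b c a b * (2 * f a ^+ 2) +
      \sum_a \sum_b c a b * (2 * f b ^+ 2)).
    rewrite [X in _ = _ + X]exchange_big -big_split mulr_sumr /=.
    apply: eq_bigr => a _; rewrite -!big_split mulr_suml mulr_sumr /=.
    by apply: eq_bigr => b _; rewrite (csym b a); ring.
  rewrite -big_split; apply: eq_bigr => a _; rewrite -big_split /=.
  by apply: eq_bigr => b _; rewrite mulrDr.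
apply: ler_sum => a _; apply: ler_sum => b _; rewrite ler_wpM2l //.
by have := sqr_ge0 (f a + f b); nra.
Qed.

(** A single edge term is at most the whole energy, so each step of a path changes [f] by at most
    the square root of energy over [t]. *)
Lemma connect_energy (e : rel T) c (t : R) f a b :
  (forall a b, 0 <= c a b) -> 0 < t ->
  (forall x y, e x y -> t <= c x y) -> connect e a b ->
  `|f a - f b| <= #|T|%:R * Num.sqrt (energy c f / t).
Proof.
move=> c0 t0 te; apply: connect_norm_le; first exact: sqrtr_ge0.
move=> x y xy; rewrite -sqrtr_sqr ler_wsqrtr // ler_pdivlMr // mulrC.
apply: le_trans (energy_edge f x y c0).
by rewrite ler_wpM2r ?sqr_ge0 // te.
Qed.

End Energy.

(** * Stability on an abstract graph whose boundary weights are scaled by [eta] *)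

Section GraphStability.
Variables (R : realType) (T : finType) (c : T -> T -> R) (e bdry : rel T).
Hypotheses (c_ge0 : forall a b, 0 <= c a b)
  (c_sym : forall a b, c a b = c b a)
  (c_gt0 : forall a b, e a b -> 0 < c a b)
  (e_connected : forall a b, connect e a b)
  (bdry_sub : subrel bdry e) (bdry_sym : symmetric bdry).

Let scaled (eta : R) a b := (if bdry a b then eta else 1) * c a b.
Let N : R := #|T|%:R.
Let total : R := \sum_a \sum_b c a b.
(* Terms with c a b = 0 contribute 0, since 0^-1 = 0. *)
Let inv_total : R := 1 + \sum_a \sum_b (c a b)^-1.

Lemma inv_total_gt0 : 0 < inv_total.
Proof.
by rewrite ltr_pwDl //; do 2!apply: sumr_ge0 => ? _; rewrite invr_ge0.
Qed.

(** The inverse of one weight is among the nonnegative terms of [inv_total], whose inverse thus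
    replaces the minimal edge weight. *)
Lemma inv_total_edge a b : e a b -> inv_total^-1 <= c a b.
Proof.
move=> /c_gt0 cab.
rewrite -[leRHS]invrK lef_pV2 ?posrE ?invr_gt0 ?inv_total_gt0 //.
rewrite /inv_total (bigD1 a) //= (bigD1 b) //= [leRHS]addrC -!addrA lerDl.
by rewrite !addr_ge0 //; repeat (apply: sumr_ge0 => ? _); rewrite invr_ge0.
Qed.

Lemma scaled_ge0 eta : 1 <= eta -> forall a b, 0 <= scaled eta a b.
Proof.
by move=> eta1 a b; rewrite mulr_ge0 //; case: ifP => _ //; lra.
Qed.

Lemma scaled_sym eta a b : scaled eta a b = scaled eta b a.
Proof. by rewrite /scaled bdry_sym c_sym. Qed.

Lemma degree_le (t eta : R) a :
  0 <= t -> (forall b, (if bdry a b then eta else 1) <= t) ->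
  \sum_b scaled eta a b <= t * total.
Proof.
move=> t0 ht; apply: (@le_trans _ _ (t * \sum_b c a b)).
  by rewrite mulr_sumr; apply: ler_sum => b _; rewrite ler_wpM2r.
rewrite ler_wpM2l // /total [leRHS](bigD1 a) //= lerDl.
by do 2!apply: sumr_ge0 => ? _.
Qed.

Section Projection.
Variables (Q : T -> T -> R) (eta : R).
Hypotheses (eta_ge1 : 1 <= eta) (Q_row : forall a, \sum_b Q a b = 1)
  (Q_le1 : forall a b, `|Q a b| <= 1)
  (Q_blocks : forall a b, Q a b != 0 ->
     (forall x, ~~ bdry a x) \/ connect bdry a b).

Lemma residual_le (u : T -> R) (t : R) a :
  (forall b, Q a b != 0 -> `|u a - u b| <= t) ->
  `|u a - \sum_b Q a b * u b| <= N * t.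
Proof.
move=> ut; have -> : u a - \sum_b Q a b * u b = \sum_b Q a b * (u a - u b).
  rewrite -{1}[u a]mul1r -(Q_row a) mulr_suml -sumrB.
  by apply: eq_bigr => b _; ring.
apply: le_trans (ler_norm_sum _ _ _) _.
apply: le_trans (_ : \sum_(b : T) t <= _); last first.
  by rewrite sumr_const mulr_natl.
(* A row with sum 1 has a nonzero entry, and there [t] bounds an absolute value. *)
have t0 : 0 <= t.
  have [b Qb|Q0] := pickP (fun b => Q a b != 0); first exact: le_trans (ut b Qb).
  have := Q_row a; rewrite big1 => [/esym/eqP|b _]; first by rewrite oner_eq0.
  by apply/eqP; have /negbFE := Q0 b.
apply: ler_sum => b _; have [->|Qb] := eqVneq (Q a b) 0.
  by rewrite mul0r normr0.
by rewrite normrM -[leRHS]mul1r ler_pM // ut.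
Qed.

Lemma vertex_bound (u : T -> R) a :
  (\sum_b scaled eta a b) * (u a - \sum_b Q a b * u b) ^+ 2 <=
    N ^+ 4 * total * inv_total * energy (scaled eta) u.
Proof.
have eta0 : 0 < eta := lt_le_trans ltr01 eta_ge1.
have E0 : 0 <= energy (scaled eta) u by apply/energy_ge0/scaled_ge0.
(* Common to both kinds of vertices: [t] bounds the scaling of the degree from above and, up to
   [inv_total], the weights along [ed] from below, so it cancels. *)
have key t (ed : rel T) : 0 < t ->
    (forall b, (if bdry a b then eta else 1) <= t) ->
    (forall x y, ed x y -> t * inv_total^-1 <= scaled eta x y) ->
    (forall b, Q a b != 0 -> connect ed a b) ->
    (\sum_b scaled eta a b) * (u a - \sum_b Q a b * u b) ^+ 2 <=
    N ^+ 4 * total * inv_total * energy (scaled eta) u.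
  move=> t0 dt edt Qconn.
  set s := N * Num.sqrt (energy (scaled eta) u / (t * inv_total^-1)).
  have /residual_le us b : Q a b != 0 -> `|u a - u b| <= s.
    move=> /Qconn; apply: connect_energy => //; first exact: scaled_ge0.
    by rewrite divr_gt0 ?inv_total_gt0.
  have us2 : (u a - \sum_b Q a b * u b) ^+ 2 <= (N * s) ^+ 2.
    by rewrite -[leLHS]real_normK ?num_real // lerXn2r ?nnegrE ?(le_trans _ us).
  apply: (@le_trans _ _ (t * total * (N * s) ^+ 2)).
    apply: ler_pM; rewrite ?sqr_ge0 ?degree_le ?(ltW t0) //.
    by apply: sumr_ge0 => b _; exact: scaled_ge0.
  rewrite !exprMn sqr_sqrtr; last first.
    by rewrite divr_ge0 // mulr_ge0 ?invr_ge0 ?ltW ?inv_total_gt0.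
  rewrite le_eqVlt; apply/orP; left; apply/eqP; field.
  by rewrite !gt_eqF ?inv_total_gt0.
have [inn|] := boolP [forall x, ~~ bdry a x].
  (* No boundary edge at [a]: paths may use the whole connected graph, since scaling by [eta >= 1]
     only increases weights. *)
  apply: (key 1 e) => // [b|x y xy].
    by rewrite (negbTE (forallP inn b)).
  rewrite mul1r; apply: le_trans (inv_total_edge xy) _.
  by rewrite -[leLHS]mul1r ler_wpM2r //; case: ifP.
rewrite negb_forall => /existsP[x0 ax0].
(* Here the path must stay on boundary edges, the only ones whose weight grows with [eta]. *)
apply: (key eta bdry) => // [b|x y xy|b /Q_blocks[] //].
- by case: ifP.
- by rewrite /scaled xy ler_wpM2l ?(ltW eta0) // inv_total_edge ?bdry_sub.
- by move=> /(_ x0); move: ax0 => /negbNE ->.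
Qed.

Lemma graph_stability (u w : T -> R) :
  (forall a, w a = \sum_b Q a b * u b) ->
  \sum_a (\sum_b scaled eta a b) * (u a - w a) ^+ 2
    + energy (scaled eta) w / 2 <=
  (2 + 10 * N ^+ 5 * total * inv_total) * (energy (scaled eta) u / 2).
Proof.
move=> wE; set E := energy _ u; set S := \sum_a _.
have s0 := scaled_ge0 eta_ge1.
have SE : S <= N ^+ 5 * total * inv_total * E.
  apply: le_trans (_ : \sum_(a : T) N ^+ 4 * total * inv_total * E <= _).
    by apply: ler_sum => a _; rewrite wE; exact: vertex_bound.
  by rewrite sumr_const -mulr_natl (exprS N 4) !mulrA.
have wuv : energy (scaled eta) w <= 2 * (E + 4 * S).
  have -> : w = fun a => u a + - (u a - w a) by apply/funext => a; ring.
  apply: le_trans (energyD _ _ s0) _; rewrite energyN ler_pM2l // lerD2l.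
  exact: (energy_le_diag _ s0 (@scaled_sym eta)).
(* The left side is at most S + (E + 4 S) = E + 5 S; the constants double because the right side has
   E / 2. *)
lra.
Qed.

End Projection.
End GraphStability.

(** * Quadratic forms and weights of the mesh graph *)

Lemma quad_form_diag (R : realType) n (d : 'rV[R]_n) (u : 'cV[R]_n) :
  quad_form (diag_mx d) u = \sum_i d ord0 i * u i ord0 ^+ 2.
Proof.
rewrite /quad_form mxE; apply: eq_bigr => i _.
by rewrite mul_mx_diag !mxE; ring.
Qed.

Lemma quad_form_sum (R : realType) n (A : 'M[R]_n) (u : 'cV[R]_n) :
  quad_form A u = \sum_i \sum_j A i j * u i ord0 * u j ord0.
Proof.
rewrite /quad_form mxE exchange_big; apply: eq_bigr => j _.
rewrite mxE mulr_suml; apply: eq_bigr => i _; rewrite mxE; ring.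
Qed.

Section Weights.
Context {R : realType} {p : nat} (M : dg_mesh R p).
Hypothesis (p_gt0 : (0 < p)%N).

Lemma width_gt0 i : 0 < width M i.
Proof.
have [inc _ _ _] := subP M; rewrite /width /bound subr_gt0; apply: inc.
by rewrite lift0 lift_max.
Qed.

Lemma bound_itv i b : -1 <= bound M i b <= 1.
Proof.
have [inc x0 x1 _] := subP M.
have xle : {homo sub_x M : i j / (i <= j)%N >-> i <= j}.
  move=> j k; rewrite leq_eqVlt => /predU1P[/val_inj -> //|/inc].
  exact: ltW.
by rewrite -x0 -x1 /bound !xle // -ltnS ltn_ord.
Qed.

Lemma face_in_coarse_face (f : side M) b :
  side_pos f = (if b then 1 else -1) -> in_coarse_face M (face f).
Proof.
move=> fb; exists f.1.1, f.2.1, b; apply: image_subset => y [yc /= yf].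
split=> [d|d b']; last first.
  by rewrite /facet; case: eqP => // -> [<-]; rewrite yf fb.
have := yc d; have := bound_itv (f.1.2 d) false.
have := bound_itv (f.1.2 d) true.
by rewrite /cell_itv /=; lra.
Qed.

(** The planes of index 0 and p + 1 are the facets of the coarse element. Excluding them makes both
    [inord] indices in [sigma] genuine. *)
Lemma plane_index_itv (f : side M) :
  ~ in_coarse_face M (face f) -> (0 < plane_index f <= p)%N.
Proof.
have [_ x0 x1 _] := subP M.
move=> inner; rewrite /plane_index; case E : f.2.2 => /=.
  rewrite addn1 /= ltnNge; apply/negP => pf; apply: inner.
  apply: (@face_in_coarse_face f true).
  rewrite -x1 /side_pos /bound E; congr sub_x; apply/val_inj => /=.
  rewrite /bump add1n; congr _.+1; apply/eqP; rewrite eqn_leq andbC.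
  by apply/andP; split; [exact: pf | rewrite -ltnS; exact: ltn_ord].
rewrite addn0 -[(_ <= p)%N]ltnS ltn_ord andbT lt0n; apply/negP => /eqP pf.
apply: inner; apply: (@face_in_coarse_face f false).
rewrite -x0 /side_pos /bound E; congr sub_x; apply/ord_inj; rewrite lift_max.
by rewrite pf.
Qed.

Lemma sigma_gt0 eta e : 0 < eta -> 0 < alpha M e -> 0 < sigma M eta e.
Proof.
move=> eta0 a0; move: (a0); rewrite {1}/alpha /sigma.
(* If no pair of sides is found, [alpha] has its default value 0, against its positivity. *)
case E : (sides_of M e) => [[f g]|]; last by rewrite ltxx.
have fe : face f = e.
  move: E; rewrite /sides_of; case: pickP => // -[f' g'] /=.
  by move=> /andP[_ /asboolP[fe _]] [<- _].
have w0 : 0 < \prod_(c | c != f.2.1) gl_w M (f.1.2 c).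
  by apply: prodr_gt0 => c _; exact: gauss_lobatto_weight_gt0 (glP M) _.
have [inc _ _ _] := glP M.
move=> _; case: asboolP => [_|inner].
  by rewrite mulr_gt0 // mulr_gt0 ?exprn_gt0 ?ltr0n ?mulr_gt0.
rewrite divr_gt0 // mulr_gt0 //.
  by apply: prodr_gt0 => c _; exact: width_gt0.
rewrite -fe in inner; have /andP[k0 kp] := plane_index_itv inner.
rewrite /width /bound subr_gt0; apply: inc.
by rewrite !inordK ?ltnS ?prednK // (leq_trans (leq_pred _)).
Qed.

Lemma adj_sym : symmetric (adj (M := M)).
Proof.
move=> a b; rewrite /adj eq_sym; congr (_ && asbool (_ !=set0)%classic).
by apply/seteqP; split=> e [].
Qed.

Lemma common_face_sym (a b : vertex M) : common_face a b = common_face b a.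
Proof.
by congr xget; apply/seteqP; split=> e [].
Qed.

Lemma bdry_adj_sym : symmetric (bdry_adj (M := M)).
Proof. by move=> a b; rewrite /bdry_adj adj_sym common_face_sym. Qed.

Lemma weight_sym eta (a b : vertex M) : weight eta a b = weight eta b a.
Proof. by rewrite /weight adj_sym common_face_sym. Qed.

Lemma weight_diag eta (a : vertex M) : weight eta a a = 0.
Proof. by rewrite /weight /adj eqxx. Qed.

(** This isolates [eta]: the weights at [eta = 1] serve as the fixed weights of the abstract
    graph. *)
Lemma weight_scale eta (a b : vertex M) :
  weight eta a b = (if bdry_adj a b then eta else 1) * weight 1 a b.
Proof.
rewrite /weight /bdry_adj; case: (adj a b); last by rewrite mulr0.
rewrite /sigma /=; case: (sides_of _ _) => [[f _]|]; last by rewrite mulr0.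
by case: asboolP => _; rewrite ?mul1r // mulr1; ring.
Qed.

Lemma same_block (Q : 'M[R]_#|vertex M|) i j :
  decoupled Q -> Q i j != 0 ->
  (forall x, ~~ bdry_adj (enum_val i) x) \/
  connect (bdry_adj (M := M)) (enum_val i) (enum_val j).
Proof.
move=> dec /dec[B + /andP[]]; rewrite !inE => /predU1P[->|].
  by rewrite inE => /forallP; left.
(* Both vertices are reached from the representative [x] of their class; symmetry reverses one of
   the paths. *)
move=> /imsetP[x _ ->]; rewrite !inE => /andP[_ xi] /andP[_ xj]; right.
rewrite (sym_connect_sym bdry_adj_sym) in xi.
exact: connect_trans xj.
Qed.

Lemma quad_form_laplacian eta (u : 'cV[R]_#|vertex M|) :
  quad_form (laplacian M eta) u =
    energy (weight eta) (fun a => u (enum_rank a) ord0) / 2.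
Proof.
set f := fun a => _; pose d a := \sum_b weight (M := M) eta a b.
have Lf a : \sum_b laplacian M eta (enum_rank a) (enum_rank b) * f a * f b =
    d a * f a ^+ 2 - \sum_b weight eta a b * f a * f b.
  rewrite (bigD1 a) //= mxE eqxx enum_rankK -mulrA -expr2; congr (_ + _).
  rewrite [in RHS](bigD1 a) //= weight_diag !mul0r add0r -sumrN.
  apply: eq_bigr => b ba; rewrite mxE.
  case: eqP => [/enum_rank_inj ab|_]; first by rewrite ab eqxx in ba.
  by rewrite !enum_rankK !mulNr.
rewrite quad_form_sum (reindex _ (onW_bij _ (enum_rank_bij (vertex M)))) /=.
transitivity (\sum_a (d a * f a ^+ 2 - \sum_b weight eta a b * f a * f b)).
  apply: eq_bigr => a _; rewrite -Lf.
  by rewrite (reindex _ (onW_bij _ (enum_rank_bij (vertex M)))).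
(* After doubling, the degree term is written once with [f a] and once with [f b], which completes
   the squares. *)
apply: (@mulIf _ 2); first by rewrite pnatr_eq0.
rewrite divfK ?pnatr_eq0 // mulr_natr mulr2n.
have dl : \sum_a d a * f a ^+ 2 = \sum_a \sum_b weight eta a b * f a ^+ 2.
  by apply: eq_bigr => a _; rewrite mulr_suml.
have dr : \sum_a d a * f a ^+ 2 = \sum_a \sum_b weight eta a b * f b ^+ 2.
  rewrite dl exchange_big; apply: eq_bigr => a _.
  by apply: eq_bigr => b _; rewrite weight_sym.
rewrite sumrB {1}dl dr -!sumrB -big_split; apply: eq_bigr => a _.
rewrite -!sumrB -big_split; apply: eq_bigr => b _ /=; ring.
Qed.

End Weights.

(** * The orthogonal projection onto the range of the interpolation *)

Lemma mulmx_tr_eq0 (R : realFieldType) (k n : nat) (A : 'M[R]_(k, n)) :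
  A *m A^T = 0 -> A = 0.
Proof.
move=> AA; apply/matrixP => i j; rewrite mxE.
have := congr1 (fun B : 'M[R]_k => B i i) AA; rewrite !mxE => /eqP.
rewrite psumr_eq0 => [/allP/(_ j)|l _]; last by rewrite mxE -expr2 sqr_ge0.
by rewrite mem_index_enum mxE -expr2 sqrf_eq0 => /(_ isT) /eqP.
Qed.

Lemma gram_unit (R : realFieldType) (m n : nat) (P : 'M[R]_(m, n)) :
  (forall x : 'cV[R]_n, P *m x = 0 -> x = 0) -> P^T *m P \in unitmx.
Proof.
move=> Pinj; rewrite -row_free_unit; apply: inj_row_free => x xPP.
have : x *m P^T = 0.
  by apply: mulmx_tr_eq0; rewrite trmx_mul trmxK mulmxA -(mulmxA x) xPP mul0mx.
move=> /(congr1 trmx); rewrite trmx_mul trmxK trmx0 => /Pinj.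
by move=> /(congr1 trmx); rewrite trmxK trmx0.
Qed.

(** Symmetry and idempotence make [Q i i] the sum of the squares in row [i]; so
    [Q i k ^+ 2 <= Q i i], and [k = i] gives [Q i i <= 1]. *)
Lemma orthogonal_proj_entry_le1 (R : realFieldType) (n : nat) (Q : 'M[R]_n) :
  Q^T = Q -> Q *m Q = Q -> forall i j, `|Q i j| <= 1.
Proof.
move=> QT QQ i j.
have Qsym a b : Q b a = Q a b by rewrite -[in LHS]QT mxE.
have Qii k : Q i k ^+ 2 <= Q i i.
  rewrite -[in leRHS]QQ mxE (bigD1 k) //= Qsym -expr2 lerDl.
  by apply: sumr_ge0 => l _; rewrite Qsym -expr2 sqr_ge0.
have Qi1 : Q i i <= 1.
  have := Qii i; have := sqr_ge0 (Q i i - 1); nra.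
rewrite -(@ler_sqr _ _ 1) ?nnegrE // expr1n real_normK ?num_real //.
exact: le_trans (Qii j) Qi1.
Qed.

Section RangeProj.
Context {R : realType} {p : nat} {M : dg_mesh R p}.
Variables (C : {set vertex M}) (P : 'M[R]_(#|vertex M|, #|C|)).
Hypothesis P_interp : interpolation P.

(** The rows of [P] at coarse points form an identity matrix, so [P] is injective. *)
Lemma interpolation_unit : P^T *m P \in unitmx.
Proof.
apply: gram_unit => x Px; apply/colP => j; rewrite mxE.
have := congr1
  (fun y : 'cV[R]_#|vertex M| => y (enum_rank (enum_val j)) ord0) Px.
rewrite !mxE (bigD1 j) //= P_interp ?enum_rankK ?enum_valP // eqxx mul1r.
rewrite big1 ?addr0 // => k kj.
rewrite P_interp ?enum_rankK ?enum_valP // (inj_eq enum_val_inj).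
by rewrite eq_sym (negbTE kj) mul0r.
Qed.

Lemma range_proj_id : range_proj P *m P = P.
Proof.
by rewrite /range_proj -!mulmxA mulVmx ?mulmx1 // interpolation_unit.
Qed.

Lemma range_proj_idem : range_proj P *m range_proj P = range_proj P.
Proof. by rewrite {2}/range_proj !mulmxA range_proj_id. Qed.

Lemma range_proj_tr : (range_proj P)^T = range_proj P.
Proof.
by rewrite /range_proj !trmx_mul trmx_inv !trmx_mul !trmxK mulmxA.
Qed.

(** The constant vector lies in the range of [P], which the projection fixes. *)
Lemma range_proj_row_sum :
  P *m const_mx 1 = const_mx 1 :> 'cV[R]_#|vertex M| ->
  forall i, \sum_j range_proj P i j = 1.
Proof.
move=> P1 i.
have : range_proj P *m const_mx 1 = const_mx 1 :> 'cV[R]_#|vertex M|.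
  by rewrite -P1 mulmxA range_proj_id.
move=> /(congr1 (fun y : 'cV[R]_#|vertex M| => y i ord0)); rewrite !mxE => <-.
by apply: eq_bigr => j _; rewrite [const_mx _ _ _]mxE mulr1.
Qed.

End RangeProj.

(** * Stability of the decomposition on the mesh *)

Unset Implicit Arguments.
Set Strict Implicit.

Theorem theorem4 (R : realType) (p : nat) (hp : (0 < p)%N) (M : dg_mesh R p)
    (G_connected : forall a b : vertex M, connect (adj (M := M)) a b)
    (alpha_gt0 : forall a b : vertex M,
       adj a b -> 0 < alpha M (common_face a b)) :
  exists K : R,
    forall eta : R, 1 <= eta ->
    forall (C : {set vertex M}) (P : 'M[R]_(#|vertex M|, #|C|)),
      interpolation P ->
      P *m const_mx 1 = const_mx 1 :> 'cV[R]_#|vertex M| ->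
      decoupled (range_proj P) ->
    forall u v w : 'cV[R]_#|vertex M|,
      w = range_proj P *m u ->
      u = v + w ->
      quad_form (laplacian_diag M eta) v + quad_form (laplacian M eta) w
        <= K * quad_form (laplacian M eta) u.
Proof.
have c_gt0 (a b : vertex M) : adj a b -> 0 < weight 1 a b.
  by move=> ab; rewrite /weight ab; apply: sigma_gt0 (alpha_gt0 _ _ ab).
have c_ge0 (a b : vertex M) : 0 <= weight 1 a b.
  have [/c_gt0/ltW //|nab] := boolP (adj a b).
  by rewrite /weight (negbTE nab).
(* The witness is fixed by [graph_stability] below. It is built from the number of vertices and the
   weights at [eta = 1], hence independent of [eta], [P] and [u]. *)
eexists => eta eta_ge1 C P Pinterp P1 dec u v w wE uvw.
set Q := range_proj P in wE dec.
have scaleE : weight (M := M) eta =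
    fun a b => (if bdry_adj a b then eta else 1) * weight 1 a b.
  by apply/funext => a; apply/funext => b; exact: weight_scale.
pose f (y : 'cV[R]_#|vertex M|) (a : vertex M) := y (enum_rank a) ord0.
have bij := onW_bij xpredT (enum_rank_bij (vertex M)).
have diagE : quad_form (laplacian_diag M eta) v =
    \sum_a (\sum_b weight eta a b) * (f u a - f w a) ^+ 2.
  rewrite quad_form_diag (reindex _ bij) /=; apply: eq_bigr => a _.
  rewrite !mxE eqxx enum_rankK; congr (_ * _ ^+ 2).
  by rewrite /f uvw mxE addrK.
rewrite diagE !quad_form_laplacian -/(f u) -/(f w) scaleE.
apply: (@graph_stability _ _ _ (adj (M := M)) (bdry_adj (M := M)) c_ge0 _ c_gt0
  G_connected _ _ (fun a b => Q (enum_rank a) (enum_rank b)) eta eta_ge1).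
- by move=> a b; exact: weight_sym.
- by move=> a b /andP[].
- exact: bdry_adj_sym.
- move=> a; rewrite -(range_proj_row_sum Pinterp P1 (enum_rank a)).
  by rewrite [RHS](reindex _ bij).
- move=> a b; apply: orthogonal_proj_entry_le1.
    exact: range_proj_tr.
  exact: range_proj_idem.
- by move=> a b /(same_block dec); rewrite !enum_rankK.
- by move=> a; rewrite /f wE mxE (reindex _ bij).
Qed.
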